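(* For fixed $n\ge2$, at most $\binom{n+2}{3}$ weight vectors $(0,m_2,m_3,m_4)$ of integers with $0\le m_2\le m_3\le m_4\le n-1$ satisfy $$m_2+m_3+m_4\equiv\beta\pmod n,\qquad m_2+m_3+m_4\ge n+1,\qquad 0\le m_2\le m_3\le m_4.$$
   Context: Here $\beta\in\mathbb{Z}_n$ is the class $\beta\equiv m_1+m_2+m_3+m_4\pmod n$ with $m_1=0$, i.e. the weight of the monomial $x_1x_2x_3x_4$ under the $\mathbb{Z}_n$-action $x_j\mapsto\delta^{m_j}x_j$ on $\mathbb{P}^3$; it is the common weight of the monomials of the bidegree $(2,4)$ equation of an anticanonical hypersurface in $(\mathbb{P}^1\times\mathbb{P}^3)/\mathbb{Z}_n$ (with $\mathbb{Z}_n$ acting trivially on $\mathbb{P}^1$). *)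

(* Defs.v *)
From mathcomp Require Import all_boot all_order all_algebra.

Set Implicit Arguments.
Unset Strict Implicit.
Unset Printing Implicit Defensive.

Import GRing.Theory.
Local Open Scope ring_scope.

(* Weights m_1, ..., m_4 of the action x_j |-> delta^(m_j) x_j of Z_n on P^3,
   as integers in [0, n-1]. The paper's index j is the element j - 1 of 'I_4,
   so m_1, m_2, m_3, m_4 are m 0, m 1, m 2, m 3. *)
Definition weights (n : nat) := {ffun 'I_4 -> 'I_n}.

(* Weight in Z_n of the monomial x_1^(e_1) x_2^(e_2) x_3^(e_3) x_4^(e_4).
   'Z_n is the ring of integers mod n only for n >= 2. *)
Definition monomial_weight (n : nat) (m : weights n) (e : 'I_4 -> nat) : 'Z_n :=
  \sum_(j < 4) (e j * m j)%N%:R.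

(* The weight of x_1 x_2 x_3 x_4; it is a function of the weight vector m. *)
Definition beta (n : nat) (m : weights n) : 'Z_n :=
  monomial_weight m (fun=> 1%N).

Definition admissible (n : nat) (b : 'Z_n) (m : weights n) : bool :=
  let m1 : nat := m 0 in
  let m2 : nat := m 1 in
  let m3 : nat := m 2 in
  let m4 : nat := m 3 in
  [&& m1 == 0%N,
      (m2 + m3 + m4)%N%:R == b,
      (n + 1 <= m2 + m3 + m4)%N
    & [&& 0 <= m2, m2 <= m3 & m3 <= m4]%N].

(* Main.v *)
Require Import Defs.
From mathcomp Require Import all_boot all_order all_algebra.

(** A weight vector with [m_1 = 0] is determined by its last three entries, and
    the ordering makes these a weakly increasing triple in [{0, ..., n-1}], that
    is, a multiset of size 3 on [n] points. There are [binom(n+2, 3)] such multisets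
    ([card_sorted_tuples]), and the map to triples is injective
    ([tail_triple_inj]). *)

Definition tail_triple n (m : weights n) : 3.-tuple 'I_n :=
  [tuple m (1%R : 'I_4); m (2%R : 'I_4); m (3%R : 'I_4)].

Lemma tail_triple_inj n :
  {in [pred m : weights n | val (m (0%R : 'I_4)) == 0] &, injective (@tail_triple n)}.
Proof.
move=> m m' /eqP m0 /eqP m'0 /(congr1 val) [e1 e2 e3].
apply/ffunP=> j.
have /or4P[] : [|| j == 0%R, j == 1%R, j == 2%R | j == 3%R].
  by case: j => [[|[|[|[|]]]]].
all: move/eqP=> -> //.
by apply: val_inj; rewrite m0 m'0.
Qed.

Lemma tail_triple_sorted n (b : 'Z_n) (m : weights n) :
  admissible b m -> sorted leq (map val (tail_triple n m)).
Proof. by case/and4P=> _ _ _ /and3P[_ le23 le34] /=; rewrite le23 le34. Qed.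

Theorem theorem3p6 (n : nat) (hn : 2 <= n) :
  #|[set m : weights n | admissible (beta m) m]| <= 'C(n + 2, 3).
Proof.
(* [card_sorted_tuples] counts triples in ['I_n.+1], whence the shift of [n]. *)
case: n hn => // n _.
rewrite addSnnS addnC -card_sorted_tuples -(card_in_imset (f := @tail_triple n.+1)).
  apply/subset_leq_card/subsetP=> _ /imsetP[m + ->].
  by rewrite !inE => /tail_triple_sorted.
move=> m m'; rewrite !inE => /and4P[m0 _ _ _] /and4P[m'0 _ _ _].
exact: tail_triple_inj.
Qed.
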